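(* Let $\{P_\alpha\}$ be a graded basis of QSym. The following are equivalent: (i) $\{P_\alpha\}$ is a QPS basis, and $P_\alpha = \sum_\beta c_{\alpha\beta} M_\beta$ for some integers $c_{\alpha\beta} \ge 0.$ (ii) There exists a total order $\prec$ on $\mathbb{Z}_{>0}$ such that \[ P_\alpha = \mathrm{aut}(\alpha) \sum_{\alpha \le' \beta} \frac{1}{\mathrm{aut}(\alpha,\beta)} M_\beta, \] where $\alpha \le' \beta$ if $\alpha \le \beta$ and every $\alpha^{(i)}$ has weakly increasing parts with respect to $\prec.$
   Context: Work over a field $\mathbbm{k}$ of characteristic zero. For a composition $\alpha$ (finite sequence of positive integers), $m_i(\alpha)$ is the number of parts equal to $i$, $\mathrm{aut}(\alpha)=\prod_i m_i(\alpha)!$, $\prod(\alpha)$ is the product of parts, $z_\alpha=\mathrm{aut}(\alpha)\prod(\alpha)$. For $|\alpha|=|\beta|$, $\alpha\le\beta$ means $\alpha=\alpha^{(1)}\cdots\alpha^{(\ell(\beta))}$ (concatenation) with $\alpha^{(i)}$ a composition of $\beta_i$, and $\mathrm{aut}(\alpha,\beta)=\prod_i\mathrm{aut}(\alpha^{(i)})$. $\{M_\alpha\}$ is the monomial basis of $\mathrm{QSym}$, $p_\lambda$ the symmetric power sums, $\alpha\sim\beta$ means rearrangement, and $\alpha \sqcup\!\sqcup \beta$ is the multiset of compositions of length $\ell(\alpha)+\ell(\beta)$ containing $\alpha,\beta$ as disjoint subsequences, with multiplicity. A QPS (quasisymmetric power sum) basis is a graded basis $\{P_\alpha\}$ of $\mathrm{QSym}$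 with $P_\alpha P_\beta=\frac{z_\alpha z_\beta}{z_{\alpha\beta}}\sum_{\gamma\in\alpha \sqcup\!\sqcup \beta}P_\gamma$, $\Delta(P_\alpha)=\sum_{\beta\gamma=\alpha}\frac{z_\alpha}{z_\beta z_\gamma}P_\beta\otimes P_\gamma$, and $\sum_{\alpha\sim\lambda}P_\alpha=p_\lambda$ for every partition $\lambda$. *)

(* Defs.v *)
From mathcomp Require Import all_boot all_order all_algebra.
From mathcomp.multinomials Require Export freeg mpoly.

Set Implicit Arguments.
Unset Strict Implicit.
Unset Printing Implicit Defensive.

Import GRing.Theory.
Local Open Scope ring_scope.

Definition posint := {n : nat | (0 < n)%N}.

Definition composition := seq posint.

Definition parts (a : composition) : seq nat := [seq val i | i <- a].

Definition weight (a : composition) : nat := sumn (parts a).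

Definition aut (a : composition) : nat := (\prod_(i <- undup a) (count_mem i a)`!)%N.

Definition zee (a : composition) : nat := (aut a * \prod_(i <- parts a) i)%N.

Definition is_partition (a : composition) : bool := sorted geq (parts a).

(* The only candidate for the factorization of [a] into compositions of the
   successive entries of [b]: each block is the longest prefix of what remains
   of [a] whose weight does not exceed the entry (see [blocks_unique]). *)
Fixpoint blocks (a : composition) (b : seq nat) : seq composition :=
  if b is n :: b' then
    let k := find (fun i => n < weight (take i.+1 a))%N (iota 0 (size a)) in
    take k a :: blocks (drop k a) b'
  else [::].

Definition refines (a b : composition) : bool :=
  (flatten (blocks a (parts b)) == a) &&
  ([seq weight s | s <- blocks a (parts b)] == parts b).

Definition aut2 (a b : composition) : nat := (\prod_(s <- blocks a (parts b)) aut s)%N.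

Definition refines_wrt (le : rel posint) (a b : composition) : bool :=
  refines a b && all (sorted le) (blocks a (parts b)).

Fixpoint shuffle (a : composition) : composition -> seq composition :=
  fix shuffle_a (b : composition) : seq composition :=
    match a, b with
    | [::], _ => [:: b]
    | _, [::] => [:: a]
    | i :: a', j :: b' =>
        [seq i :: c | c <- shuffle a' b] ++ [seq j :: c | c <- shuffle_a b']
    end.

Lemma blocks_unique (a : composition) (b : seq nat) (ss : seq composition) :
  flatten ss = a -> [seq weight s | s <- ss] = b -> blocks a b = ss.
Proof.
move=> <- <-; elim: ss => [|s ss IH] //=.
set k := find _ _; suff -> : k = size s by rewrite take_size_cat // drop_size_cat // IH.
have wcat (u v : composition) : weight (u ++ v) = (weight u + weight v)%N.
  by rewrite /weight /parts map_cat sumn_cat.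
set t := flatten ss in k *.
have small i : (i < size s)%N -> (weight s < weight (take i.+1 (s ++ t)))%N = false.
  move=> lt_is; apply/negbTE; rewrite -leqNgt take_cat.
  case: ltnP => [_|le_s]; first by rewrite -{2}(cat_take_drop i.+1 s) wcat leq_addr.
  have -> : i.+1 = size s by apply/eqP; rewrite eqn_leq lt_is le_s.
  by rewrite subnn take0 cats0.
rewrite /k size_cat iotaD find_cat add0n size_iota.
case: hasP => [[i]|_]; first by rewrite mem_iota add0n => /andP[_ /small->].
case: t {k small} => [|j t] /=; first by rewrite addn0.
rewrite (_ : take _ (s ++ j :: t) = s ++ [:: j]); last first.
  by rewrite take_cat ltnNge leqnSn /= subSn // subnn /= take0.
by rewrite wcat -addn1 leq_add2l /weight /= addn0 (valP j) addn0.
Qed.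

Lemma refinesP (a b : composition) :
  reflect (exists2 ss : seq composition, flatten ss = a
             & [seq weight s | s <- ss] = parts b)
          (refines a b).
Proof.
apply: (iffP andP) => [[/eqP fl /eqP wt]|[ss fl wt]]; first by exists (blocks a (parts b)).
by rewrite (blocks_unique fl wt) fl wt.
Qed.

Lemma fgliftE (K : nzRingType) (M : lmodType K) (T : choiceType) (h : T -> M)
    (D : {freeg T / K}) :
  fglift h D = \sum_(x <- dom D) coeff x D *: h x.
Proof. by rewrite -{1}(Freeg_dom D) fglift_Freeg /prelift big_map. Qed.

(* QSym is the vector space with basis the monomial quasisymmetric functions
   M_a = << a >>, so that [coeff b f] is the coefficient of M_b in f; elements
   become functions of the variables through [qs_eval]. *)
Definition QSym (K : fieldType) := {freeg composition / K}.

(* The polynomial M_a(x_1, ..., x_n); the indices of variables start at 0. *)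
Definition mono_poly (K : fieldType) (n : nat) (a : composition) : {mpoly K[n]} :=
  \sum_(i : (size a).-tuple 'I_n | sorted ltn [seq val k | k <- i])
    \prod_(j < size a) 'X_(tnth i j) ^+ val (tnth (in_tuple a) j).

(* f(x_1, ..., x_n, 0, 0, ...).  The maps [qs_eval n], for all n, are jointly
   injective (see [qs_eval_inj]) and identify QSym with the algebra of
   quasisymmetric power series of bounded degree.  An identity between products
   in QSym is an identity between polynomials in x_1, ..., x_n for every n. *)
Definition qs_eval (K : fieldType) (n : nat) (f : QSym K) : {mpoly K[n]} :=
  fglift (@mono_poly K n) f.

Lemma coeff_mono_poly (K : fieldType) (a b : composition) :
  (mono_poly K (size a) b)@_[multinom nth 0%N (parts a) i | i < size a] =
  (b == a)%:R.
Proof.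
set n := size a; set m := [multinom _ | i < n].
have sz (c : composition) : size (parts c) = size c by rewrite size_map.
have nthE (c : composition) (j : 'I_(size c)) :
    val (tnth (in_tuple c) j) = nth 0%N (parts c) j.
  by case: c j => [[]//|x c] j; rewrite (tnth_nth x) (nth_map x).
pose mu (i : (size b).-tuple 'I_n) : 'X_{1..n} :=
  (\sum_(j < size b) U_(tnth i j) *+ nth 0%N (parts b) j)%MM.
have muE i k : mu i k = (\sum_(j < size b | tnth i j == k) nth 0%N (parts b) j)%N.
  rewrite mnm_sumE [RHS]big_mkcond; apply: eq_bigr => j _.
  by rewrite mulmnE mnm1E; case: eqP; rewrite ?mul1n.
have iotaP (i : (size b).-tuple 'I_n) : sorted ltn [seq val k | k <- i] ->
    mu i = m -> [seq val k | k <- i] = iota 0 n.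
  move=> si mui; apply: (irr_sorted_eq ltn_trans ltnn si (iota_ltn_sorted _ _)).
  move=> k; rewrite mem_iota add0n /=; apply/mapP/idP => [[l _ ->]//|lt_kn].
  exists (Ordinal lt_kn) => //; apply/negPn/negP => nik.
  have : (0 < m (Ordinal lt_kn))%N.
    by rewrite mnmE /= (nth_map (nth (exist _ 1%N isT) a 0)) // (valP (nth _ a k)).
  rewrite -mui muE big_pred0 // => j.
  by apply: contraNF nik => /eqP <-; rewrite mem_tnth.
have nth_iota (i : (size b).-tuple 'I_n) (j : 'I_(size b)) :
    [seq val k | k <- i] = iota 0 n -> tnth i j = j :> nat.
  have sbn : [seq val k | k <- i] = iota 0 n -> size b = n.
    by move=> /(congr1 size); rewrite size_map size_tuple size_iota.
  move=> ii; rewrite (tnth_nth (tnth i j)) -(nth_map _ 0%N val) ?size_tuple //.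
  by rewrite ii nth_iota // -(sbn ii).
have muN (i : (size b).-tuple 'I_n) : sorted ltn [seq val k | k <- i] ->
    mu i = m -> b = a.
  move=> si mui; have ii := iotaP i si mui.
  have sbn : size b = n by move/(congr1 size): ii; rewrite size_map size_tuple size_iota.
  apply: (inj_map val_inj); apply: (@eq_from_nth _ 0%N); rewrite ?size_map //.
  move=> k lt_kb; have lt_kn : (k < n)%N by rewrite -sbn.
  move/(congr1 (fun u : 'X_{1..n} => u (Ordinal lt_kn))): mui.
  rewrite muE mnmE /= (big_pred1 (Ordinal lt_kb)) // => j.
  by rewrite -!val_eqE /= nth_iota.
have muX (i : (size b).-tuple 'I_n) :
    (\prod_(j < size b) 'X_(tnth i j) ^+ val (tnth (in_tuple b) j))@_m =
    (mu i == m)%:R :> K.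
  rewrite -mcoeffX /mu (big_morph _ (@mpolyXD n K) (@mpolyX0 n K)).
  by congr (mcoeff _ _); apply: eq_bigr => j _; rewrite nthE mpolyXn.
rewrite /mono_poly raddf_sum /= (eq_bigr _ (fun i _ => muX i)).
case: (eqVneq b a) => [eq_ba|neq_ba]; last first.
  rewrite big1 // => i si; case: eqP => // mui.
  by rewrite (muN i si mui) eqxx in neq_ba.
have t_P : size (enum 'I_n) == size b by rewrite size_enum_ord eq_ba.
have t_iota : [seq val k | k <- Tuple t_P] = iota 0 n by rewrite /= val_enum_ord.
have t_mu : mu (Tuple t_P) = m.
  apply/mnmP => k; rewrite muE mnmE.
  have lt_kb : (k < size b)%N by rewrite eq_ba.
  rewrite (big_pred1 (Ordinal lt_kb)) /= ?eq_ba // => j.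
  by rewrite -!val_eqE /= nth_iota.
rewrite (bigD1 (Tuple t_P)) /= ?t_mu ?eqxx; last first.
  by rewrite val_enum_ord iota_ltn_sorted.
rewrite big1 ?addr0 // => i /andP[si neq_it]; case: eqP => // mui.
case/eqP: neq_it; apply: val_inj; apply: (inj_map val_inj).
by rewrite /= (iotaP i si mui) -t_iota.
Qed.

Lemma coeff_qs_eval (K : fieldType) (f : QSym K) (a : composition) :
  (qs_eval (size a) f)@_[multinom nth 0%N (parts a) i | i < size a] =
  coeff a f.
Proof.
rewrite /qs_eval fgliftE raddf_sum -[in RHS](freeg_sumE f) raddf_sum /=.
by apply: eq_bigr => b _; rewrite mcoeffZ coeff_mono_poly coeffU.
Qed.

Lemma qs_eval_inj (K : fieldType) (f g : QSym K) :
  (forall n : nat, qs_eval n f = qs_eval n g) -> f = g.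
Proof.
by move=> eq_fg; apply/eqP/freeg_eqP => a; rewrite -!coeff_qs_eval eq_fg.
Qed.

Definition power_sum (K : fieldType) (n : nat) (l : composition) : {mpoly K[n]} :=
  \prod_(i <- parts l) \sum_(j < n) 'X_j ^+ i.

(* QSym (x) QSym, where << (b, c) >> stands for M_b (x) M_c. *)
Definition QSym2 (K : fieldType) := {freeg (composition * composition)%type / K}.

Definition tensor (K : fieldType) (f g : QSym K) : QSym2 K :=
  fglift (fun b : composition =>
    fglift (fun c : composition => << (b, c) >> : QSym2 K) g) f.

Definition coproduct (K : fieldType) (f : QSym K) : QSym2 K :=
  fglift (fun a : composition =>
    \sum_(i < (size a).+1) << (take i a, drop i a) >> : QSym2 K) f.

Definition homogeneous (K : fieldType) (d : nat) (f : QSym K) : Prop :=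
  forall b : composition, b \in dom f -> weight b = d.

(* The coordinates of f in the family P are finitely supported on composition. *)
Definition is_basis (K : fieldType) (P : composition -> QSym K) : Prop :=
  forall f : QSym K, exists! x : {freeg composition / K}, f = fglift P x.

Definition graded_basis (K : fieldType) (P : composition -> QSym K) : Prop :=
  (forall a : composition, homogeneous (weight a) (P a)) /\ is_basis P.

Record QPS_basis (K : fieldType) (P : composition -> QSym K) : Prop := {
  QPS_graded_basis : graded_basis P;
  QPS_product : forall (a b : composition) (n : nat),
    qs_eval n (P a) * qs_eval n (P b) =
    ((zee a)%:R * (zee b)%:R / (zee (a ++ b))%:R) *:
      \sum_(c <- shuffle a b) qs_eval n (P c);
  QPS_coproduct : forall a : composition,
    coproduct (P a) =
    \sum_(i < (size a).+1)
      ((zee a)%:R / ((zee (take i a))%:R * (zee (drop i a))%:R)) *: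
        tensor (P (take i a)) (P (drop i a));
  QPS_power_sum : forall (l : composition) (n : nat), is_partition l ->
    qs_eval n (\sum_(a <- permutations l) P a) = power_sum K n l
}.

Definition total_order (le : rel posint) : Prop :=
  [/\ reflexive le, antisymmetric le, transitive le & total le].

(* Main.v *)
Require Import Defs.
From mathcomp Require Import all_boot all_order all_algebra.
From mathcomp Require Import ring zify.

Set Implicit Arguments.
Unset Strict Implicit.
Unset Printing Implicit Defensive.

Import Order.TTheory GRing.Theory Num.Theory.
Local Open Scope ring_scope.

(* Put q_a = P_a / z_a.  The product and coproduct formulas say that q is
   multiplicative for shuffles and comultiplicative for deconcatenation.  By
   comultiplicativity the coefficient of M_b in q_a is the product of phi over
   the blocks of a, where phi(s) is the coefficient of the one-part M in q_s, and
   evaluating q at finitely many variables is an iterated convolution of the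
   functions a |-> phi(a) x^|a|.  Convolution preserves characters of the shuffle
   algebra, so the product formula holds iff phi is such a character; it holds for
   phi(a) = 1 / z_a on sorted words and 0 elsewhere.  Conversely, let
   g(a) = phi(a) * (product of the parts of a), so that aut(a) g(a) is a
   nonnegative integer.  If g(u) g(v) = 0 then g vanishes on every shuffle of u
   and v.  Hence i <= j iff g(i j) <> 0 defines a total order, g vanishes on
   unsorted words, and a character with these zeros is determined by its values
   g(i) = 1 on letters. *)

(** * Shuffle sums and shuffle characters *)

Definition shuffle_sum (V : nmodType) (f : composition -> V) (a b : composition) : V :=
  \sum_(c <- shuffle a b) f c.

(** The zero function qualifies: the value 1 at the empty word is a separate hypothesis wherever it
    matters. *)
Definition shuffle_character (R : comNzRingType) (f : composition -> R) : Prop :=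
  forall a b : composition, f a * f b = shuffle_sum f a b.

(** The product dual to deconcatenation. *)
Definition conv (R : comNzRingType) (f g : composition -> R) (a : composition) : R :=
  \sum_(i < (size a).+1) f (take i a) * g (drop i a).

Lemma shuffle0s (a : composition) : shuffle [::] a = [:: a].
Proof. by case: a. Qed.

Lemma shuffles0 (a : composition) : shuffle a [::] = [:: a].
Proof. by case: a. Qed.

Lemma shuffle_sum0s (V : nmodType) (f : composition -> V) a : shuffle_sum f [::] a = f a.
Proof. by rewrite /shuffle_sum shuffle0s big_seq1. Qed.

Lemma shuffle_sums0 (V : nmodType) (f : composition -> V) a : shuffle_sum f a [::] = f a.
Proof. by rewrite /shuffle_sum shuffles0 big_seq1. Qed.

Lemma shuffle_sum_cons (V : nmodType) (f : composition -> V) i a j b :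
  shuffle_sum f (i :: a) (j :: b) =
  shuffle_sum (f \o cons i) a (j :: b) + shuffle_sum (f \o cons j) (i :: a) b.
Proof. by rewrite /shuffle_sum /= big_cat !big_map. Qed.

Lemma shuffle_sumZD (R : comNzRingType) (k : R) (f g : composition -> R) a b :
  shuffle_sum (fun c => k * f c + g c) a b = k * shuffle_sum f a b + shuffle_sum g a b.
Proof. by rewrite /shuffle_sum mulr_sumr big_split. Qed.

Lemma eq_shuffle_sum (V : nmodType) (f g : composition -> V) a b :
  f =1 g -> shuffle_sum f a b = shuffle_sum g a b.
Proof. by move=> fg; apply: eq_bigr => c _. Qed.

Lemma perm_shuffle (a b c : composition) : c \in shuffle a b -> perm_eq c (a ++ b).
Proof.
elim: a b c => [|i a IHa] b c; first by rewrite shuffle0s inE => /eqP->.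
elim: b c => [|j b IHb] c; first by rewrite shuffles0 inE cats0 => /eqP->.
rewrite /= mem_cat => /orP[] /mapP[d d_in ->]; first by rewrite /= perm_cons IHa.
rewrite (perm_trans (_ : perm_eq _ (j :: i :: a ++ b))) ?perm_cons ?IHb //.
by rewrite -(cat1s j b) -!cat_cons perm_sym perm_catCA.
Qed.

Lemma cat_in_shuffle (a b : composition) : a ++ b \in shuffle a b.
Proof.
elim: a => [|i a IH]; first by rewrite shuffle0s inE.
case: b IH => [|j b] IH; first by rewrite shuffles0 cats0 inE.
by rewrite /= mem_cat map_f.
Qed.

Arguments shuffle : simpl never.

(** * Convolution *)

Lemma conv0 (R : comNzRingType) (f g : composition -> R) : conv f g [::] = f [::] * g [::].
Proof. by rewrite /conv big_ord1. Qed.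

Lemma conv_cons (R : comNzRingType) (f g : composition -> R) i a :
  conv f g (i :: a) = f [::] * g (i :: a) + conv (f \o cons i) g a.
Proof. by rewrite /conv /= big_ord_recl. Qed.

Lemma convDZl (R : comNzRingType) (k : R) (f f' g : composition -> R) a :
  conv (fun c => k * f c + f' c) g a = k * conv f g a + conv f' g a.
Proof.
rewrite /conv mulr_sumr -big_split; apply: eq_bigr => i _ /=.
by rewrite mulrDl mulrA.
Qed.

Lemma eq_conv (R : comNzRingType) (f f' g g' : composition -> R) :
  f =1 f' -> g =1 g' -> conv f g =1 conv f' g'.
Proof. by move=> ff gg a; apply: eq_bigr => i _; rewrite ff gg. Qed.

(** The induction moves the head letter of the word into the leftmost function, which therefore
    stays general. *)
Lemma convA (R : comNzRingType) (f g h : composition -> R) a :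
  conv (conv f g) h a = conv f (conv g h) a.
Proof.
elim: a f => [|i a IH] f; first by rewrite !conv0 mulrA.
rewrite !conv_cons conv0 mulrDr mulrA -addrA -IH; congr (_ + _).
by rewrite -convDZl; apply: eq_conv => // c /=; rewrite conv_cons.
Qed.

(* Deconcatenation is a morphism for the shuffle product. *)
Lemma shuffle_sum_conv (R : comNzRingType) (f g : composition -> R) a b :
  shuffle_sum (conv f g) a b =
  \sum_(i < (size a).+1) \sum_(j < (size b).+1)
    shuffle_sum f (take i a) (take j b) * shuffle_sum g (drop i a) (drop j b).
Proof.
have [n] := ubnP (size a + size b); elim: n => // n IH in f a b *; rewrite ltnS => le_n.
case: a le_n => [|x a] le_n.
  rewrite shuffle_sum0s big_ord1; apply: eq_bigr => j _.
  by rewrite !shuffle_sum0s.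
case: b le_n => [|y b] le_n.
  rewrite shuffle_sums0; apply: eq_bigr => j _.
  by rewrite big_ord1 !shuffle_sums0.
have conv_consE z : conv f g \o cons z =1
    (fun c => f [::] * g (z :: c) + conv (f \o cons z) g c).
  by move=> c; rewrite /= conv_cons.
rewrite shuffle_sum_cons !(eq_shuffle_sum _ _ (conv_consE _)) !shuffle_sumZD.
(* The terms with an empty prefix on the [f] side recombine into the full shuffle sum of [g]. *)
rewrite addrACA -mulrDr -(shuffle_sum_cons g) !IH //; last by rewrite /= addnS in le_n.
rewrite [RHS]big_ord_recl [X in _ = X + _]big_ord_recl /=.
rewrite !shuffle_sum0s.
rewrite -addrA; congr (_ + _).
(* When both prefixes are nonempty, the first letter of their shuffle comes from either word; the
   two halves match the two uses of the induction hypothesis. *)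
under [X in _ = _ + X]eq_bigr => p _.
  rewrite big_ord_recl /= shuffle_sums0.
  under eq_bigr => q _ do rewrite shuffle_sum_cons mulrDl.
  rewrite big_split /= addrA; over.
rewrite big_split /= addrCA; congr (_ + _).
  by apply: eq_bigr => p _; rewrite [LHS]big_ord_recl /= shuffle_sums0.
rewrite [LHS]big_ord_recl /=; congr (_ + _).
by apply: eq_bigr => q _; rewrite !shuffle_sum0s.
Qed.

Lemma conv_character (R : comNzRingType) (f g : composition -> R) :
  shuffle_character f -> shuffle_character g -> shuffle_character (conv f g).
Proof.
move=> chf chg a b; rewrite shuffle_sum_conv /conv mulr_suml.
apply: eq_bigr => i _; rewrite mulr_sumr; apply: eq_bigr => j _.
by rewrite -chf -chg mulrACA.
Qed.

Lemma counit_character (R : comNzRingType) :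
  shuffle_character (fun a : composition => (a == [::])%:R : R).
Proof.
case=> [|i a] [|j b]; rewrite ?shuffle_sum0s ?shuffle_sums0 ?mul1r ?mulr1 //.
rewrite mul0r shuffle_sum_cons /shuffle_sum !big1 ?addr0 //.
Qed.

(** * Weights and symmetry factors *)

Lemma weight_cat (a b : composition) : weight (a ++ b) = (weight a + weight b)%N.
Proof. by rewrite /weight /parts map_cat sumn_cat. Qed.

Lemma weight_eq0 (a : composition) : (weight a == 0%N) = (a == [::]).
Proof. by case: a => //= -[[]]. Qed.

Lemma perm_weight (a b : composition) : perm_eq a b -> weight a = weight b.
Proof. by move=> ab; apply/perm_sumn/perm_map. Qed.

(** A common index list lets the symmetry factors of different words be compared letter by
    letter. *)
Lemma autE (s a : composition) : uniq s -> {subset a <= s} ->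
  aut a = (\prod_(i <- s) (count_mem i a)`!)%N.
Proof.
move=> us sub; rewrite [RHS](bigID (mem a)) /= [X in (_ * X)%N]big1 ?muln1.
  rewrite -big_filter /aut; apply/perm_big/uniq_perm; rewrite ?undup_uniq ?filter_uniq //.
  by move=> i; rewrite mem_undup mem_filter; case: (boolP (i \in a)) => // /sub ->.
by move=> i /count_memPn ->.
Qed.

Lemma aut_cons i (a : composition) : aut (i :: a) = ((count_mem i a).+1 * aut a)%N.
Proof.
have us := undup_uniq (i :: a).
rewrite (@autE (undup (i :: a)) (i :: a)) // => [|x]; last by rewrite mem_undup.
rewrite (@autE (undup (i :: a)) a) // => [|x xa]; last by rewrite mem_undup inE xa orbT.
have is_in : i \in undup (i :: a) by rewrite mem_undup mem_head.
rewrite !(big_rem i is_in) /= eqxx factS mulnA; congr (_ * _)%N.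
apply: eq_big_seq => j; rewrite (mem_rem_uniq _ us) inE eq_sym => /andP[/negbTE-> _].
by [].
Qed.

Lemma perm_aut (a b : composition) : perm_eq a b -> aut a = aut b.
Proof.
move=> ab; rewrite (@autE (undup b) a) ?undup_uniq // => [|x].
  by apply: eq_bigr => i _; rewrite (permP ab).
by rewrite mem_undup (perm_mem ab).
Qed.

Lemma aut_gt0 (a : composition) : (0 < aut a)%N.
Proof. by rewrite prodn_gt0 // => i; rewrite fact_gt0. Qed.

(** The quotient is a product of binomial coefficients, one for each letter. *)
Lemma dvdn_aut_cat (a b : composition) : (aut a * aut b %| aut (a ++ b))%N.
Proof.
set s := undup (a ++ b); have us : uniq s by exact: undup_uniq.
rewrite (@autE s a) ?(@autE s b) ?(@autE s (a ++ b)) // => [|x|x|x]; rewrite ?mem_undup ?mem_cat;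
  try by move=> ->; rewrite ?orbT.
rewrite -big_split /=; elim/big_ind2: _ => // [m1 n1 m2 n2|i _]; first exact: dvdn_mul.
rewrite count_cat -(bin_fact (leq_addr (count_mem i b) (count_mem i a))).
by rewrite addKn dvdn_mull.
Qed.

(** This makes the coefficients in condition (ii) integers. *)
Lemma dvdn_aut2 (a b : composition) : refines a b -> (aut2 a b %| aut a)%N.
Proof.
rewrite /refines /aut2 => /andP[/eqP fl _]; rewrite -{2}fl.
elim: (blocks _ _) => [|s ss IH]; first by rewrite big_nil dvd1n.
by rewrite big_cons (dvdn_trans _ (dvdn_aut_cat _ _)) // dvdn_mul.
Qed.

Lemma prod_parts_gt0 (a : composition) : (0 < \prod_(i <- parts a) i)%N.
Proof. by rewrite /parts big_map prodn_gt0 // => i; exact: valP. Qed.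

Lemma zee_gt0 (a : composition) : (0 < zee a)%N.
Proof. by rewrite muln_gt0 aut_gt0 prod_parts_gt0. Qed.

Lemma perm_zee (a b : composition) : perm_eq a b -> zee a = zee b.
Proof.
by move=> ab; rewrite /zee (perm_aut ab) (perm_big (parts b)) // perm_map.
Qed.

(** * Characters of the shuffle algebra *)

Lemma shuffle_sumC (V : nmodType) (f : composition -> V) a b :
  shuffle_sum f a b = shuffle_sum f b a.
Proof.
elim: a f b => [|i a IHa] f b; first by rewrite shuffle_sum0s shuffle_sums0.
elim: b f => [|j b IHb] f; first by rewrite shuffle_sum0s shuffle_sums0.
by rewrite !shuffle_sum_cons IHa IHb addrC.
Qed.

Lemma subseq_shuffle (a b c : composition) : c \in shuffle a b -> subseq a c.
Proof.
elim: a b c => [|i a IHa] b c; first by rewrite sub0seq.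
elim: b c => [|j b IHb] c; first by rewrite shuffles0 inE => /eqP->.
rewrite mem_cat => /orP[] /mapP[d d_in ->]; first by rewrite /= eqxx (IHa _ _ d_in).
by apply: subseq_trans (IHb _ d_in) (subseq_cons _ _).
Qed.

Lemma shuffle_sum_eq0 (V : nmodType) (f : composition -> V) a b :
  (forall c, c \in shuffle a b -> f c = 0) -> shuffle_sum f a b = 0.
Proof. by move=> f0; rewrite /shuffle_sum big_seq big1. Qed.

Lemma eq_in_shuffle_sum (V : nmodType) (f g : composition -> V) a b :
  (forall c, c \in shuffle a b -> f c = g c) -> shuffle_sum f a b = shuffle_sum g a b.
Proof. by move=> fg; apply: eq_big_seq. Qed.

Lemma shuffle_sumZ (R : comNzRingType) (k : R) (f : composition -> R) a b :
  shuffle_sum (fun c => k * f c) a b = k * shuffle_sum f a b.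
Proof. by rewrite /shuffle_sum mulr_sumr. Qed.

(** All words of a shuffle have the same multiset of letters, so [w] is constant on them. The lemma
    serves to insert or remove the product of the parts. *)
Lemma twist_character (R : comNzRingType) (w f : composition -> R) :
  (forall a b c, perm_eq c (a ++ b) -> w c = w a * w b) ->
  shuffle_character f -> shuffle_character (fun a => w a * f a).
Proof.
move=> w_mul chf a b; rewrite mulrACA chf -shuffle_sumZ; apply: eq_in_shuffle_sum.
by move=> c /perm_shuffle/w_mul->.
Qed.

Definition sorted_inv_aut (K : fieldType) (le : rel posint) (a : composition) : K :=
  if sorted le a then (aut a)%:R^-1 else 0.


Lemma sorted_inv_aut_cons (K : fieldType) (le : rel posint) i (a : composition) :
  transitive le -> all (le i) a ->
  sorted_inv_aut K le (i :: a) = (count_mem i a).+1%:R^-1 * sorted_inv_aut K le a.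
Proof.
move=> le_tr le_i; rewrite /sorted_inv_aut /= path_sortedE // le_i /=.
by case: sorted; rewrite ?mulr0 // aut_cons natrM invfM.
Qed.

(** A sorted shuffle starts with the smaller of the two heads, which gives an induction on the total
    length. For equal heads both choices contribute, and the multiplicities balance. *)
Lemma sorted_inv_aut_character (K : fieldType) (charK0 : [pchar K] =i pred0)
    (le : rel posint) :
  total_order le -> shuffle_character (sorted_inv_aut K le).
Proof.
case=> le_refl le_anti le_tr le_total.
set g := sorted_inv_aut K le.
have g0 : g [::] = 1 by rewrite /g /sorted_inv_aut /aut big_nil invr1.
move=> a b; have [n] := ubnP (size a + size b); elim: n => // n IH in a b *; rewrite ltnS.
case: a => [|i a]; first by rewrite shuffle_sum0s g0 mul1r.
case: b => [|j b]; first by rewrite shuffle_sums0 g0 mulr1.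
wlog le_ij : i j a b / le i j.
  move=> hw le_n; have /orP[le_ij|le_ji] := le_total i j; first exact: hw.
  by rewrite mulrC shuffle_sumC; apply: hw => //; rewrite addnC.
(* A word with an unsorted subsequence is unsorted, so if either factor is unsorted both sides
   vanish. *)
move=> le_n; have [sa|nsa] := boolP (sorted le (i :: a)); last first.
  rewrite {1}/g /sorted_inv_aut (negbTE nsa) mul0r shuffle_sum_eq0 // => c /subseq_shuffle sub.
  by rewrite /g /sorted_inv_aut ifN //; apply: contra nsa; apply: subseq_sorted.
have [sb|nsb] := boolP (sorted le (j :: b)); last first.
  rewrite mulrC shuffle_sumC {1}/g /sorted_inv_aut (negbTE nsb) mul0r shuffle_sum_eq0 //.
  move=> c /subseq_shuffle sub.
  by rewrite /g /sorted_inv_aut ifN //; apply: contra nsb; apply: subseq_sorted.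
have ai : all (le i) a by move: sa; rewrite /= path_sortedE // => /andP[].
have bj : all (le j) b by move: sb; rewrite /= path_sortedE // => /andP[].
have bi : all (le i) b by apply: sub_all bj => k; apply: le_tr.
(* When [k] precedes every letter of [u] and [v], prepending it multiplies [g] by the same factor on
   every shuffle. *)
have head (k : posint) u v : all (le k) (u ++ v) -> (size u + size v < n)%N ->
    shuffle_sum (g \o cons k) u v = (count_mem k (u ++ v)).+1%:R^-1 * (g u * g v).
  move=> all_k lt_n; rewrite IH // -shuffle_sumZ; apply: eq_in_shuffle_sum.
  move=> c /perm_shuffle perm_c; rewrite /= /g sorted_inv_aut_cons //.
    by rewrite (permP perm_c).
  by rewrite (perm_all _ perm_c).
rewrite shuffle_sum_cons head ?all_cat /= ?ai ?le_ij //.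
have nz m : m.+1%:R != 0 :> K by move/pcharf0P: charK0 => ->.
rewrite [g (i :: a)]sorted_inv_aut_cons // -/g.
case: (eqVneq i j) => [eq_ij|neq_ij]; last first.
  (* A word starting with [j] and containing the strictly smaller [i] is unsorted, so only the
     shuffles starting with [i] count. *)
  rewrite shuffle_sum_eq0 => [|c /perm_shuffle perm_c].
    rewrite addr0 count_cat /= eq_sym (negbTE neq_ij).
    have /count_memPn -> : i \notin b.
      by apply: contra neq_ij => /(allP bj) le_ji; rewrite (le_anti i j) ?le_ij ?le_ji.
    by rewrite !addn0 mulrA.
  rewrite /= /g /sorted_inv_aut /= path_sortedE // ifN //.
  rewrite negb_and; apply/orP; left; apply/negP => /allP /(_ i).
  rewrite (perm_mem perm_c) mem_head => /(_ isT) le_ji.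
  by rewrite (le_anti i j) ?eqxx // ?le_ij in neq_ij.
subst j; rewrite head ?all_cat /= ?ai ?le_ij ?bi //; last by rewrite /= addnS in le_n.
rewrite ![g (i :: _)]sorted_inv_aut_cons // -/g !count_cat /= eqxx ?add1n ?addnS ?addSn.
(* What remains is (1/(x+1) + 1/(y+1)) / (x+y+2) = 1/((x+1)(y+1)). *)
set x := count_mem i a; set y := count_mem i b.
have := nz x; have := nz y; have := nz (x + y).+1.
rewrite -!natr1 !natrD => h1 h2 h3; field.
by rewrite h1 h2 h3.
Qed.

Lemma inv_prod_parts_mul (K : fieldType) (a b c : composition) : perm_eq c (a ++ b) ->
  ((\prod_(i <- parts c) i)%:R^-1 : K) =
  (\prod_(i <- parts a) i)%:R^-1 * (\prod_(i <- parts b) i)%:R^-1.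
Proof.
move=> perm_c; rewrite (perm_big (parts (a ++ b))) ?perm_map //.
by rewrite /parts map_cat big_cat natrM invfM.
Qed.

Definition sorted_inv_zee (K : fieldType) (le : rel posint) (a : composition) : K :=
  if sorted le a then (zee a)%:R^-1 else 0.

Lemma sorted_inv_zeeE (K : fieldType) (le : rel posint) (a : composition) :
  sorted_inv_zee K le a = (\prod_(i <- parts a) i)%:R^-1 * sorted_inv_aut K le a.
Proof.
rewrite /sorted_inv_zee /sorted_inv_aut /zee natrM invfM.
by case: sorted; rewrite ?mulr0 // mulrC.
Qed.

Lemma sorted_inv_zee_character (K : fieldType) (charK0 : [pchar K] =i pred0)
    (le : rel posint) :
  total_order le -> shuffle_character (sorted_inv_zee K le).
Proof.
move=> le_ord a b; rewrite (eq_shuffle_sum _ _ (sorted_inv_zeeE K le)) !sorted_inv_zeeE.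
rewrite -(twist_character (@inv_prod_parts_mul K)) //.
exact: sorted_inv_aut_character.
Qed.

Lemma intr_pchar0_eq0 (K : fieldType) (charK0 : [pchar K] =i pred0) (m : int) :
  (m%:~R == 0 :> K) = (m == 0).
Proof.
case: m => n; first by rewrite -pmulrn (pcharf0P K).1.
by rewrite NegzE mulrNz oppr_eq0 -pmulrn (pcharf0P K).1.
Qed.


(* A character vanishing off the sorted compositions is determined by its
   values on singletons: only one word of the shuffle of [i] with [a] is sorted. *)
Lemma sorted_character_cons (K : fieldType) (le : rel posint) (f : composition -> K) i a :
  total_order le -> shuffle_character f -> (forall c, ~~ sorted le c -> f c = 0) ->
  sorted le (i :: a) ->
  f [:: i] * f a = f (i :: a) *+ count_mem (i :: a) (shuffle [:: i] a).
Proof.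
case=> _ le_anti le_tr _ chf f0 sa.
rewrite chf /shuffle_sum (bigID (pred1 (i :: a))) /= [X in _ + X]big_seq_cond.
rewrite [X in _ + X]big1 => [|c /andP[/perm_shuffle perm_c neq_c]]; last first.
  by apply: f0; apply: contra neq_c => sc; apply/eqP/(sorted_eq le_tr le_anti sc sa).
rewrite addr0 (eq_bigr (fun=> f (i :: a))) => [|c /eqP-> //].
by rewrite big_const_seq iter_addr_0.
Qed.

Lemma nonneg_character_sorted (K : fieldType) (charK0 : [pchar K] =i pred0)
    (f : composition -> K) (c : composition -> int) :
  shuffle_character f -> (forall i, f [:: i] = 1) -> f [::] = 1 ->
  (forall a, 0 <= c a) -> (forall a, (aut a)%:R * f a = (c a)%:~R) ->
  exists2 le : rel posint, total_order le & f =1 sorted_inv_aut K le.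
Proof.
move=> chf f1 f0 c_ge0 fc.
have autNZ a : (aut a)%:R != 0 :> K by rewrite (pcharf0P K).1 // -lt0n aut_gt0.
have f_eq0 a : (f a == 0) = (c a == 0).
  by rewrite -(intr_pchar0_eq0 charK0) -fc mulf_eq0 (negbTE (autNZ a)).
(* A vanishing shuffle sum of nonnegative terms has only zero terms. *)
have null u v w : f u * f v = 0 -> w \in shuffle u v -> f w = 0.
  move=> fuv w_in; apply/eqP; rewrite f_eq0.
  have /eqP : (aut (u ++ v))%:R * shuffle_sum f u v = 0 by rewrite -chf fuv mulr0.
  rewrite -shuffle_sumZ (@eq_in_shuffle_sum _ _ (fun w => (c w)%:~R)); last first.
    by move=> d /perm_shuffle/perm_aut <-; rewrite fc.
  rewrite /shuffle_sum -raddf_sum /= intr_pchar0_eq0 // psumr_eq0 //.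
  by move/allP/(_ w w_in).
have nz1 u v w : w \in shuffle u v -> f w != 0 -> (f u != 0) && (f v != 0).
  move=> w_in; apply: contraR; rewrite -negb_or negbK -mulf_eq0 => /eqP fuv.
  by rewrite (null u v).
pose le : rel posint := fun i j => f [:: i; j] != 0.
(* The values on [i j] and [j i] add up to 1, so they cannot both vanish. *)
have le_total : total le.
  move=> i j; rewrite /le -negb_and; apply/andP => -[/eqP fij /eqP fji].
  have := chf [:: i] [:: j]; rewrite !f1 mulr1 shuffle_sum_cons shuffle_sum0s shuffle_sums0 /=.
  by rewrite fij fji addr0 => /eqP; rewrite oner_eq0.
(* For distinct letters [aut] is 1, so the values on [i j] and [j i] are nonnegative integers with
   sum 1, and one of them is zero. *)
have le_anti : antisymmetric le.
  move=> i j /andP[lij lji]; apply/eqP; apply: contraT => neq_ij.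
  have := chf [:: i] [:: j]; rewrite !f1 mulr1 shuffle_sum_cons shuffle_sum0s shuffle_sums0 /=.
  have fc2 (k l : posint) : k != l -> f [:: k; l] = (c [:: k; l])%:~R.
    by move=> neq; rewrite -fc !aut_cons /= eq_sym (negbTE neq) /aut big_nil mul1r.
  rewrite (fc2 i j) // (fc2 j i) 1?eq_sym // -intrD => /eqP.
  rewrite eq_sym -subr_eq0 -[1]/(1%:~R) -intrB.
  rewrite intr_pchar0_eq0 //; rewrite /le !f_eq0 in lij lji.
  by move: (c_ge0 [:: i; j]) (c_ge0 [:: j; i]) lij lji; lia.
have le_trans : transitive le.
  move=> j i k lij ljk; have [<- //|neq_jk] := eqVneq j k.
  have fkj : f [:: k; j] = 0.
    apply/eqP; apply: contraT => lkj; rewrite (le_anti j k) ?eqxx // in neq_jk.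
    by apply/andP; split.
  (* Each shuffle of [i j] with [k] contains [i k] or [k j] as a subsequence. If [f] vanished on
     both, it would vanish on all three shuffles, whose sum is [f [:: i; j]]. *)
  apply: contraT; rewrite negbK => /eqP fik.
  have := chf [:: i; j] [:: k].
  rewrite f1 mulr1 !shuffle_sum_cons !shuffle_sum0s !shuffle_sums0 /=.
  rewrite (null [:: i; k] [:: j] [:: i; j; k]) ?fik ?mul0r ?inE ?eqxx ?orbT //.
  rewrite (null [:: k; j] [:: i] [:: i; k; j]) ?fkj ?mul0r ?inE ?eqxx ?orbT //.
  rewrite (null [:: k; j] [:: i] [:: k; i; j]) ?fkj ?mul0r ?inE ?eqxx ?orbT //.
  by rewrite !addr0 => fij; rewrite /le fij eqxx in lij.
have le_ord : total_order le by split=> // i; have := le_total i i; rewrite orbb.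
(* If [f] is nonzero on a concatenation, it is nonzero on both factors, hence on every pair of
   adjacent letters. *)
have f_sorted a : ~~ sorted le a -> f a = 0.
  move=> nsa; apply/eqP; apply: contraNT nsa; elim: a => // i a IH fia.
  have /andP[_ /IH] := nz1 [:: i] a _ (cat_in_shuffle _ _) fia.
  case: a fia {IH} => //= j a fija ->; rewrite andbT.
  by have /andP[] := nz1 [:: i; j] a _ (cat_in_shuffle _ _) fija.
exists le => // a; have [sa|nsa] := boolP (sorted le a); last first.
  by rewrite f_sorted // /sorted_inv_aut (negbTE nsa).
have g_sorted b : ~~ sorted le b -> sorted_inv_aut K le b = 0.
  by rewrite /sorted_inv_aut => /negbTE->.
elim: a sa => [|i a IH] sa; first by rewrite f0 /sorted_inv_aut /aut big_nil invr1.
(* Both characters obey the same one-letter recursion, with the same positive multiplicity, which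
   cancels in characteristic zero. *)
have := sorted_character_cons le_ord chf f_sorted sa.
rewrite f1 IH ?(path_sorted sa) //.
have -> : 1 = sorted_inv_aut K le [:: i].
  by rewrite sorted_inv_aut_cons // /sorted_inv_aut /aut big_nil /= !invr1 mulr1.
rewrite (sorted_character_cons le_ord (sorted_inv_aut_character charK0 le_ord) g_sorted sa).
rewrite -[in LHS]mulr_natr -[in RHS]mulr_natr => /mulIf -> //.
rewrite (pcharf0P K).1 // -lt0n -has_count has_pred1.
exact: cat_in_shuffle [:: i] a.
Qed.

(** * Coproduct and evaluation *)

(** With an index list larger than the support, combinations of elements with different supports can
    be compared termwise. *)
Lemma fglift_wide (K : nzRingType) (M : lmodType K) (T : choiceType) (h : T -> M)
    (D : {freeg T / K}) (s : seq T) : uniq s -> {subset dom D <= s} ->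
  fglift h D = \sum_(x <- s) coeff x D *: h x.
Proof.
move=> us sub; rewrite fgliftE [RHS](bigID (mem (dom D))) /= [X in _ = _ + X]big1 ?addr0.
  rewrite -[RHS]big_filter; apply/perm_big/uniq_perm; rewrite ?uniq_dom ?filter_uniq //.
  by move=> x; rewrite mem_filter; case: (boolP (x \in dom D)) => //= /sub ->.
by move=> x /coeff_outdom->; rewrite scale0r.
Qed.

Lemma fgliftZ (K : nzRingType) (M : lmodType K) (T : choiceType) (h : T -> M) k
    (D : {freeg T / K}) :
  fglift h (k *: D) = k *: fglift h D.
Proof.
rewrite (fglift_wide h (uniq_dom D)) ?fgliftE ?scaler_sumr => [|x]; last exact: domZ_subset.
by apply: eq_bigr => x _; rewrite coeffZ scalerA.
Qed.

Lemma fglift_sum (K : nzRingType) (M : lmodType K) (T : choiceType) (h : T -> M)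
    (I : Type) (r : seq I) (F : I -> {freeg T / K}) :
  fglift h (\sum_(i <- r) F i) = \sum_(i <- r) fglift h (F i).
Proof.
elim/big_ind2: _ => // [|x1 D1 x2 D2 <- <-]; first by rewrite fgliftE dom0 big_nil.
set s := undup (dom D1 ++ dom D2).
have sub D : {subset dom D <= dom D1 ++ dom D2} ->
    fglift h D = \sum_(x <- s) coeff x D *: h x.
  move=> sD; apply: fglift_wide (undup_uniq _) _ => x /sD.
  by rewrite mem_undup.
rewrite !sub => [|x|x|x]; last 3 first.
- by move=> xD; rewrite mem_cat xD orbT.
- by move=> xD; rewrite mem_cat xD.
- exact: domD_subset.
by rewrite -big_split; apply: eq_bigr => x _; rewrite coeffD scalerDl.
Qed.

(** A pair of words arises from exactly one word and exactly one cut. *)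
Lemma coeff_coproduct (K : fieldType) (f : QSym K) (b c : composition) :
  coeff (b, c) (coproduct f) = coeff (b ++ c) f.
Proof.
rewrite /coproduct fgliftE raddf_sum /= -[in RHS](freeg_sumE f) raddf_sum /=.
apply: eq_bigr => a _; rewrite coeffZ coeffU raddf_sum /=; congr (_ * _).
under eq_bigr => i _ do rewrite coeffU mul1r xpair_eqE.
have [->|neq] := eqVneq a (b ++ c).
  have lt : (size b < (size (b ++ c)).+1)%N by rewrite ltnS size_cat leq_addr.
  rewrite (bigD1 (Ordinal lt)) //= take_size_cat // drop_size_cat // !eqxx.
  rewrite big1 ?addr0 // => i neq_i; case: eqP => // tk; case/eqP: neq_i; apply: val_inj.
  by rewrite /= -(congr1 size tk) size_takel // -ltnS.
rewrite big1 // => i _; case: eqP => //= tk; case: eqP => //= dr.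
by rewrite -tk -dr cat_take_drop eqxx in neq.
Qed.

Lemma coeff_tensor (K : fieldType) (f g : QSym K) (b c : composition) :
  coeff (b, c) (tensor f g) = coeff b f * coeff c g.
Proof.
rewrite /tensor fgliftE raddf_sum /= -[in coeff b f](freeg_sumE f) raddf_sum /= mulr_suml.
apply: eq_bigr => x _; rewrite coeffZ coeffU -mulrA; congr (_ * _).
rewrite fgliftE raddf_sum /= -[in coeff c g](freeg_sumE g) raddf_sum /= mulr_sumr.
apply: eq_bigr => y _; rewrite coeffZ !coeffU mul1r xpair_eqE.
by rewrite mulrCA -natrM mulnb.
Qed.

(** The tensor product of the linear extensions of [g] and [h], followed by multiplication in
    [R]. *)
Definition lift2 (K : fieldType) (R : comAlgType K) (g h : composition -> R)
    (t : QSym2 K) : R :=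
  fglift (fun bc : composition * composition => g bc.1 * h bc.2) t.

Lemma lift2_tensor (K : fieldType) (R : comAlgType K) (g h : composition -> R)
    (u v : QSym K) :
  lift2 g h (tensor u v) = fglift g u * fglift h v.
Proof.
rewrite /lift2 /tensor [X in fglift _ X]fgliftE fglift_sum (fgliftE g u) mulr_suml.
apply: eq_bigr => b _.
rewrite fgliftZ -scalerAl; congr (_ *: _).
rewrite [X in fglift _ X]fgliftE fglift_sum (fgliftE h v) mulr_sumr; apply: eq_bigr => c _.
by rewrite fgliftZ liftU scale1r scalerAr.
Qed.

(** Together with [lift2_tensor], this turns a coproduct formula for a family into a convolution
    formula for its evaluations. *)
Lemma lift2_coproduct (K : fieldType) (R : comAlgType K) (g h : composition -> R)
    (u : QSym K) :
  lift2 g h (coproduct u) = fglift (conv g h) u.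
Proof.
rewrite /lift2 /coproduct [X in fglift _ X]fgliftE fglift_sum [RHS]fgliftE; apply: eq_bigr => b _.
rewrite fgliftZ fglift_sum; congr (_ *: _); apply: eq_bigr => i _.
by rewrite liftU scale1r.
Qed.

(** * The monomial functions M_a at a finite list of values *)

Fixpoint monomial (R : comNzRingType) (xs : seq R) (a : composition) : R :=
  match xs, a with
  | _, [::] => 1
  | [::], _ => 0
  | x :: xs', i :: a' => x ^+ val i * monomial xs' a' + monomial xs' a
  end.

Lemma monomial_nil (R : comNzRingType) (xs : seq R) : monomial xs [::] = 1.
Proof. by case: xs. Qed.

Lemma monomial1 (R : comNzRingType) (x : R) i (a : composition) :
  monomial [:: x] (i :: a) = if a is [::] then x ^+ val i else 0.
Proof. by case: a => [|j a] /=; rewrite addr0 ?mulr1 ?mulr0. Qed.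

(** In one variable M_a vanishes as soon as [a] has two parts, so only the cuts after zero or one
    letter contribute. *)
Lemma monomial_conv (R : comNzRingType) (x : R) xs (a : composition) :
  monomial (x :: xs) a = conv (monomial [:: x]) (monomial xs) a.
Proof.
case: a => [|i a]; first by rewrite conv0 !monomial_nil mul1r.
rewrite conv_cons monomial_nil mul1r [LHS]/= addrC; congr (_ + _).
case: a => [|j a]; first by rewrite conv0 /= addr0 mulr1.
rewrite conv_cons [(_ \o _) _]monomial1 {1}/conv big1 ?addr0 // => k _.
by rewrite /= mulr0 !addr0 mul0r.
Qed.

Fixpoint subseqs (T : Type) (k : nat) (s : seq T) : seq (seq T) :=
  match k, s with
  | 0, _ => [:: [::]]
  | _, [::] => [::]
  | k'.+1, x :: s' => [seq x :: t | t <- subseqs k' s'] ++ subseqs k s'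
  end.

Lemma mem_subseqs (T : eqType) k (s t : seq T) : uniq s ->
  (t \in subseqs k s) = subseq t s && (size t == k).
Proof.
elim: s k t => [|x s IH] k t; first by case: k; case: t.
case: k => [|k] /andP[xs us]; first by case: t => [|y t]; rewrite inE ?andbF.
rewrite mem_cat IH //; case: t => [|y t].
  by rewrite andbF orbF; apply/negbTE/negP => /mapP[].
rewrite /= eqSS; have [->|neq_yx] := eqVneq y x.
  rewrite mem_map ?IH // => [|? ? []//]; rewrite orb_idr // => /andP[sub _].
  by rewrite (mem_subseq sub) ?mem_head in xs.
by rewrite orb_idl // => /mapP[? _ [eq_yx]]; rewrite eq_yx eqxx in neq_yx.
Qed.

Lemma subseqs_uniq (T : eqType) k (s : seq T) : uniq s -> uniq (subseqs k s).
Proof.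
elim: s k => [|x s IH] [|k] //= /andP[xs us]; rewrite cat_uniq !IH // andbT.
rewrite map_inj_uniq ?IH //=; last by move=> ? ? [].
apply/hasPn => t; rewrite mem_subseqs // => /andP[sub _]; apply/negP => /mapP[u _ eq_t].
by rewrite (mem_subseq sub) ?eq_t ?mem_head in xs.
Qed.

Lemma monomial_subseqs (R : comNzRingType) (T : Type) (X : T -> R) (s : seq T) (a : composition) :
  monomial [seq X x | x <- s] a =
  \sum_(t <- subseqs (size a) s) \prod_(ti <- zip t a) X ti.1 ^+ val ti.2.
Proof.
elim: s a => [|x s IH] [|i a] /=; rewrite ?big_nil ?big_seq1 ?big_nil // big_cat big_map !IH /=.
congr (_ + _); rewrite mulr_sumr; apply: eq_bigr => t _.
by rewrite big_cons.
Qed.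

(** The strictly increasing index tuples are exactly the subsequences of [enum 'I_n], and neither
    enumeration has repetitions. *)
Lemma mono_polyE (K : fieldType) n (a : composition) :
  mono_poly K n a = monomial [seq 'X_i | i <- enum 'I_n] a :> {mpoly K[n]}.
Proof.
rewrite monomial_subseqs /mono_poly.
transitivity (\sum_(t <- [seq val t | t <-
    enum [pred t : (size a).-tuple 'I_n | sorted ltn [seq val k | k <- t]]])
   \prod_(ti <- zip t a) 'X_(ti.1) ^+ val ti.2 : {mpoly K[n]}).
  rewrite big_map big_enum /=; apply: eq_bigr => t _.
  rewrite -[X in zip _ X]/(tval (in_tuple a)) -[X in zip X _]map_tnth_enum.
  rewrite -[X in zip _ X]map_tnth_enum zip_map.
  by rewrite big_map big_enum.
have us : uniq (enum 'I_n) by exact: enum_uniq.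
apply/perm_big/uniq_perm; rewrite ?subseqs_uniq //.
  by rewrite map_inj_uniq ?enum_uniq //; exact: val_inj.
move=> t; rewrite mem_subseqs //; apply/mapP/andP.
  case=> u; rewrite mem_enum inE => su ->; rewrite size_tuple eqxx; split=> //.
  (* A strictly increasing list is determined by its set of entries. *)
  suff -> : val u = [seq i <- enum 'I_n | i \in val u] by exact: filter_subseq.
  apply: (inj_map val_inj); apply: (irr_sorted_eq ltn_trans ltnn su).
    rewrite sorted_map; apply: (sorted_filter (leT := relpre val ltn)).
      by move=> ? ? ?; apply: ltn_trans.
    by rewrite -sorted_map val_enum_ord iota_ltn_sorted.
  move=> k; apply/mapP/mapP => -[i]; last first.
    by rewrite mem_filter => /andP[i_in _] ->; exists i.
  by move=> i_in ->; exists i; rewrite // mem_filter mem_enum andbT.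
case=> sub size_t; exists (Tuple size_t) => //; rewrite mem_enum inE /=.
apply: (subseq_sorted ltn_trans (map_subseq val sub)).
by rewrite val_enum_ord iota_ltn_sorted.
Qed.

(* The coefficient of M_b in q_a, when f gives the coefficients of the one-part M. *)
Fixpoint block_coeff (R : comNzRingType) (f : composition -> R) (b : composition) :
    composition -> R :=
  if b is n :: b' then
    conv (fun s => (weight s == val n)%:R * f s) (block_coeff f b')
  else fun a => (a == [::])%:R.

Lemma conv_counit (R : comNzRingType) (g : composition -> R) a :
  conv (fun c => (c == [::])%:R) g a = g a.
Proof.
case: a => [|i a]; first by rewrite conv0 mul1r.
by rewrite conv_cons mul1r {1}/conv big1 ?addr0 // => k _; rewrite mul0r.
Qed.

Lemma block_coeff_cat (R : comNzRingType) (f : composition -> R) b c a :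
  block_coeff f (b ++ c) a = conv (block_coeff f b) (block_coeff f c) a.
Proof.
elim: b a => [|n b IH] a; first by rewrite conv_counit.
by rewrite /= convA; apply: eq_conv.
Qed.

Lemma refines_cons (a : composition) n (b : composition) :
  let k := find (fun i => val n < weight (take i.+1 a))%N (iota 0 (size a)) in
  refines a (n :: b) = (weight (take k a) == val n) && refines (drop k a) b.
Proof.
move=> k; rewrite /refines /= -/k -[X in (_ ++ _) == X](cat_take_drop k a).
rewrite eqseq_cat // eqxx /= eqseq_cons.
by rewrite andbCA.
Qed.

(** Parts are positive, so at most one prefix has a prescribed weight, and each convolution has at
    most one nonzero term. *)
Lemma block_coeffE (R : comNzRingType) (f : composition -> R) b a :
  block_coeff f b a = if refines a b then \prod_(s <- blocks a (parts b)) f s else 0.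
Proof.
elim: b a => [|n b IH] a.
  by rewrite /refines /= andbT eq_sym; case: eqP; rewrite ?big_nil.
rewrite refines_cons /= big_cons; set k := find _ _.
have le_k : (k < (size a).+1)%N by rewrite ltnS -[leqRHS](size_iota 0) find_size.
rewrite /conv (bigD1 (Ordinal le_k)) //= big1 => [|i neq_ik].
  rewrite addr0 IH; case: eqP => _ /=; last by rewrite !mul0r.
  by rewrite mul1r; case: ifP; rewrite ?mulr0.
case: eqP => [w_i|_]; last by rewrite !mul0r.
case/eqP: neq_ik; apply: val_inj => /=.
have := @blocks_unique a [:: val n; weight (drop i a)] [:: take i a; drop i a].
rewrite /= cats0 cat_take_drop w_i -/k => /(_ erefl erefl)[/(congr1 size)].
by rewrite !size_takel // -ltnS.
Qed.

Lemma prod_parts_flatten (ss : seq composition) :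
  (\prod_(i <- parts (flatten ss)) i = \prod_(s <- ss) \prod_(i <- parts s) i)%N.
Proof.
elim: ss => [|s ss IH]; first by rewrite !big_nil.
by rewrite /= big_cons -IH /parts map_cat big_cat.
Qed.

(** The products of parts of the blocks multiply to that of [a] and cancel, leaving only the
    symmetry factors. *)
Lemma zee_prod_blocks (K : fieldType) (charK0 : [pchar K] =i pred0) (le : rel posint)
    (a b : composition) :
  (zee a)%:R *
    (if refines a b then \prod_(s <- blocks a (parts b)) sorted_inv_zee K le s else 0) =
  if refines_wrt le a b then (aut a)%:R / (aut2 a b)%:R else 0.
Proof.
rewrite /refines_wrt; case: (boolP (refines a b)) => [ab|_] /=; last by rewrite mulr0.
have [/allP srt|/allPn[s s_in nsrt]] := boolP (all _ _); last first.
  by rewrite (big_rem s) //= {1}/sorted_inv_zee (negbTE nsrt) mul0r mulr0.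
rewrite (eq_big_seq (fun s => (zee s)%:R^-1)) => [|s /srt srts]; last first.
  by rewrite /sorted_inv_zee srts.
rewrite prodfV -natr_prod.
have -> : (\prod_(s <- blocks a (parts b)) zee s = aut2 a b * \prod_(i <- parts a) i)%N.
  rewrite /zee big_split /= -prod_parts_flatten.
  by case/andP: ab => /eqP-> _.
have nz m : (0 < m)%N -> m%:R != 0 :> K by rewrite (pcharf0P K).1 // -lt0n.
have h1 := nz _ (prod_parts_gt0 a).
have h2 : (aut2 a b)%:R != 0 :> K.
  by apply: nz; rewrite /aut2 prodn_gt0 // => s; exact: aut_gt0.
by rewrite /zee !natrM; field; rewrite h1 h2.
Qed.

(** The default covers weight 0, whose only composition is empty. *)
Definition coarsest (d : nat) : composition := if insub d is Some n then [:: n] else [::].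

Lemma weight_coarsest d : weight (coarsest d) = d.
Proof.
rewrite /coarsest; case: insubP => [n _ <-|]; first by rewrite /weight /= addn0.
by rewrite -eqn0Ngt => /eqP ->.
Qed.

Lemma coarsestE (b : composition) : (size b <= 1)%N -> b = coarsest (weight b).
Proof.
case: b => [|n [|]] // _; first by rewrite /coarsest insubF.
by rewrite /coarsest /weight /= addn0 valK.
Qed.

(** * Comultiplicative families and their evaluations *)

Section Normalized.
Variables (K : fieldType) (q : composition -> QSym K).
Hypothesis q_hom : forall a, homogeneous (weight a) (q a).

Let phi (a : composition) : K := coeff (coarsest (weight a)) (q a).

Lemma coeff_weight a b : weight b != weight a -> coeff b (q a) = 0.
Proof.
by move=> neq; apply/coeff_outdom; apply: contra neq => /q_hom ->.
Qed.

Lemma coeff_singleton a n : coeff [:: n] (q a) = (weight a == val n)%:R * phi a.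
Proof.
have w_n : weight [:: n] = val n by rewrite /weight /= addn0.
case: eqP => [eq_w|/eqP neq]; last by rewrite mul0r coeff_weight // w_n eq_sym.
by rewrite mul1r /phi eq_w -w_n -coarsestE.
Qed.

(** A single variable kills every M_b with two or more parts, and homogeneity leaves one composition
    with at most one part. *)
Lemma fglift_monomial1 (R : comAlgType K) (x : R) a :
  fglift (monomial [:: x]) (q a) = phi a *: x ^+ weight a.
Proof.
rewrite (@fglift_wide _ _ _ _ _ (undup (coarsest (weight a) :: dom (q a)))) ?undup_uniq //;
  last first.
  by move=> b b_in; rewrite mem_undup inE b_in orbT.
rewrite (bigD1_seq (coarsest (weight a))) ?undup_uniq ?mem_undup ?mem_head //.
rewrite big1_seq => [|b /andP[neq_b b_in]].
  rewrite [LHS]addr0 /phi; congr (_ *: _); rewrite -[in RHS](weight_coarsest (weight a)).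
  case E: (coarsest _) => [|n s] //.
  move: E; rewrite /coarsest; case: insub => // m [<- <-].
  by rewrite monomial1 /weight /= addn0.
move: b_in; rewrite mem_undup inE (negbTE neq_b) /= => /q_hom w_b.
case: b neq_b w_b => [|i [|j b]] neq_b w_b.
- by rewrite -w_b -coarsestE ?eqxx in neq_b.
- by rewrite -w_b -coarsestE ?eqxx in neq_b.
by rewrite /= mulr0 !addr0 scaler0.
Qed.

Lemma phi_scaled_character (R : comAlgType K) (x : R) : shuffle_character phi ->
  shuffle_character (fun a => phi a *: x ^+ weight a).
Proof.
move=> chphi a b; rewrite -scalerAl -scalerAr scalerA chphi -exprD /shuffle_sum scaler_suml.
apply: eq_big_seq => c /perm_shuffle/perm_weight ->; by rewrite weight_cat.
Qed.

Hypothesis q_coproduct : forall a,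
  coproduct (q a) = \sum_(i < (size a).+1) tensor (q (take i a)) (q (drop i a)).

Lemma coeff_q_cat a b c :
  coeff (b ++ c) (q a) = conv (fun s => coeff b (q s)) (fun s => coeff c (q s)) a.
Proof.
rewrite -coeff_coproduct q_coproduct raddf_sum /=; apply: eq_bigr => i _.
by rewrite coeff_tensor.
Qed.

Hypothesis q0 : coeff [::] (q [::]) = 1.

Lemma coeff_nil_q a : coeff [::] (q a) = (a == [::])%:R.
Proof.
have [->|neq] := eqVneq a [::]; first by rewrite q0.
by rewrite coeff_weight // eq_sym weight_eq0.
Qed.

(** Separating the first part of [b] from the rest is one application of the coproduct. *)
Lemma coeff_q_block a b : coeff b (q a) = block_coeff phi b a.
Proof.
elim: b a => [|n b IH] a.
  exact: coeff_nil_q.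
rewrite -cat1s coeff_q_cat; apply: eq_conv => // c.
by rewrite coeff_singleton.
Qed.

Lemma fglift_monomial_nil (R : comAlgType K) a :
  fglift (monomial ([::] : seq R)) (q a) = (a == [::])%:R.
Proof.
rewrite (@fglift_wide _ _ _ _ _ (undup ([::] :: dom (q a)))) ?undup_uniq //; last first.
  by move=> b b_in; rewrite mem_undup inE b_in orbT.
rewrite (bigD1_seq [::]) ?undup_uniq ?mem_undup ?mem_head //= big1 ?addr0.
  by rewrite coeff_nil_q -in_algE rmorph_nat.
by case=> // i b _; rewrite scaler0.
Qed.

Lemma fglift_monomial_cons (R : comAlgType K) (x : R) (xs : seq R) a :
  fglift (monomial (x :: xs)) (q a) =
  conv (fun c => phi c *: x ^+ weight c) (fun c => fglift (monomial xs) (q c)) a.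
Proof.
have -> : fglift (monomial (x :: xs)) (q a) = fglift (conv (monomial [:: x]) (monomial xs)) (q a).
  by rewrite !fgliftE; apply: eq_bigr => b _; rewrite monomial_conv.
rewrite -lift2_coproduct q_coproduct /lift2 fglift_sum; apply: eq_bigr => i _.
by rewrite -/(lift2 _ _ _) lift2_tensor fglift_monomial1.
Qed.

Lemma fglift_monomial_character (R : comAlgType K) (xs : seq R) :
  shuffle_character phi -> shuffle_character (fun a => fglift (monomial xs) (q a)).
Proof.
move=> chphi; elim: xs => [|x xs IH] a b.
  by rewrite !fglift_monomial_nil (eq_shuffle_sum _ _ (@fglift_monomial_nil R)) counit_character.
rewrite !fglift_monomial_cons (eq_shuffle_sum _ _ (fglift_monomial_cons x xs)).
by apply: conv_character => //; apply: phi_scaled_character.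
Qed.

Lemma coeff_coarsest_nil : phi [::] = 1.
Proof. by rewrite /phi /coarsest insubF. Qed.

Lemma fglift_monomial_q0 (R : comAlgType K) (xs : seq R) : fglift (monomial xs) (q [::]) = 1.
Proof.
elim: xs => [|x xs IH]; first by rewrite fglift_monomial_nil.
by rewrite fglift_monomial_cons conv0 IH mulr1 coeff_coarsest_nil expr0 scale1r.
Qed.

(** A one-letter word has only the two trivial cuts, so its evaluation is additive over the
    variables. *)
Lemma fglift_monomial_singleton (R : comAlgType K) (xs : seq R) i :
  fglift (monomial xs) (q [:: i]) = phi [:: i] *: \sum_(x <- xs) x ^+ val i.
Proof.
elim: xs => [|x xs IH]; first by rewrite fglift_monomial_nil big_nil scaler0.
rewrite fglift_monomial_cons conv_cons conv0 fglift_monomial_q0 mulr1 expr0 IH /= big_cons.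
rewrite scalerDr addrC {1}/weight /= addn0; congr (_ + _).
by rewrite coeff_coarsest_nil scale1r mul1r.
Qed.

End Normalized.

Lemma conv_counitr (R : comNzRingType) (g : composition -> R) a :
  conv g (fun c => (c == [::])%:R) a = g a.
Proof.
elim: a g => [|i a IH] g; first by rewrite conv0 mulr1.
by rewrite conv_cons IH mulr0 add0r.
Qed.

Lemma block_coeff_coarsest (R : comNzRingType) (f : composition -> R) a :
  f [::] = 1 -> block_coeff f (coarsest (weight a)) a = f a.
Proof.
move=> f0; rewrite /coarsest; case: insubP => [n _ n_w|].
  by rewrite /= conv_counitr n_w eqxx mul1r.
by rewrite -eqn0Ngt weight_eq0 => /eqP ->; rewrite f0.
Qed.

(** * Power sums *)

Lemma shuffle_sum1 (V : nmodType) (f : composition -> V) i a :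
  shuffle_sum f [:: i] a = \sum_(0 <= k < (size a).+1) f (take k a ++ i :: drop k a).
Proof.
elim: a f => [|j a IH] f; first by rewrite shuffle_sums0 big_nat1.
rewrite shuffle_sum_cons shuffle_sum0s IH [RHS]big_nat_recl //=.
Qed.

(** A rearrangement of [i :: l] arises once for each position where it carries [i]. *)
Lemma shuffle_sum_permutations (V : nmodType) (f : composition -> V) i l :
  \sum_(a <- permutations l) shuffle_sum f [:: i] a =
  (\sum_(c <- permutations (i :: l)) f c) *+ (count_mem i l).+1.
Proof.
pose ins k (a : composition) := take k a ++ i :: drop k a.
transitivity (\sum_(a <- permutations l) \sum_(0 <= k < (size l).+1) f (ins k a)).
  apply: eq_big_seq => a; rewrite mem_permutations => perm_a.
  by rewrite shuffle_sum1 (perm_size perm_a).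
rewrite exchange_big /=.
(* For fixed [k], insertion is a bijection from the rearrangements of [l] to those of [i :: l] with
   [i] at position [k]. *)
transitivity (\sum_(0 <= k < (size l).+1)
    \sum_(c <- permutations (i :: l) | nth i c k == i) f c).
  apply: eq_big_nat => k /andP[_ lt_k].
  rewrite -[RHS]big_filter -(big_map (ins k) predT f) /=; apply/perm_big/uniq_perm.
  - rewrite map_inj_in_uniq ?permutations_uniq // => a b.
    rewrite !mem_permutations => /perm_size sa /perm_size sb /eqP.
    rewrite eqseq_cat ?size_take ?sa ?sb // eqseq_cons eqxx => /andP[/eqP tk /eqP dr].
    by rewrite -(cat_take_drop k a) tk dr cat_take_drop.
  - by rewrite filter_uniq ?permutations_uniq.
  move=> c; rewrite mem_filter mem_permutations; apply/mapP/andP.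
    case=> a; rewrite mem_permutations => perm_a ->; have sa := perm_size perm_a; split.
      by rewrite nth_cat size_takel ?sa // ltnn subnn.
    rewrite /ins -cat1s perm_catCA /= perm_cons.
    by rewrite cat_take_drop.
  case=> /eqP nth_c perm_c; have sc := perm_size perm_c; exists (take k c ++ drop k.+1 c).
    rewrite mem_permutations -(perm_cons i); apply: perm_trans perm_c.
    rewrite -cat1s perm_catCA /= -{1}nth_c -drop_nth ?cat_take_drop // sc //.
  have sk : size (take k c) = k by rewrite size_takel // sc /= ltnW.
  rewrite /ins take_size_cat // drop_size_cat // -{1}nth_c -drop_nth ?cat_take_drop // sc //.
rewrite (exchange_big_dep xpredT) ///= -sumrMnl.
apply: eq_big_seq => c; rewrite mem_permutations => perm_c.
rewrite big_mkord sumr_const -sum1_card; congr (_ *+ _).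
have -> : (count_mem i l).+1 = count_mem i c by rewrite (permP perm_c) /= eqxx.
by rewrite -sum1_count (big_nth i) big_mkord (perm_size perm_c).
Qed.

(** Multiplying by one letter at a time, the multiplicities accumulate to [aut l]. This is the
    source of the power sum identity. *)
Lemma prod_character_permutations (R : comNzRingType) (f : composition -> R) (l : composition) :
  f [::] = 1 -> shuffle_character f ->
  \prod_(i <- l) f [:: i] = (\sum_(a <- permutations l) f a) *+ aut l.
Proof.
move=> f0 chf; elim: l => [|i l IH]; first by rewrite big_nil big_seq1 f0 /aut big_nil.
rewrite big_cons IH aut_cons mulrnA -shuffle_sum_permutations mulrnAr; congr (_ *+ _).
by rewrite mulr_sumr; apply: eq_bigr => a _; exact: chf.
Qed.

(** * Normalized power sums *)

Lemma qs_evalE (K : fieldType) n (f : QSym K) :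
  qs_eval n f = fglift (monomial [seq 'X_i | i <- enum 'I_n]) f :> {mpoly K[n]}.
Proof. by rewrite /qs_eval !fgliftE; apply: eq_bigr => a _; rewrite mono_polyE. Qed.

Lemma tensorZ (K : fieldType) k l (f g : QSym K) :
  tensor (k *: f) (l *: g) = (k * l) *: tensor f g.
Proof.
apply/eqP/freeg_eqP => -[b c]; rewrite coeffZ !coeff_tensor !coeffZ.
by rewrite mulrACA.
Qed.

Section Main.
Variables (K : fieldType) (charK0 : [pchar K] =i pred0) (P : composition -> QSym K).
Hypothesis P_hom : forall a, homogeneous (weight a) (P a).

Definition normalized (a : composition) : QSym K := (zee a)%:R^-1 *: P a.

Lemma zee_neq0 (a : composition) : (zee a)%:R != 0 :> K.
Proof. by rewrite (pcharf0P K).1 // -lt0n zee_gt0. Qed.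

Lemma normalizedK a : P a = (zee a)%:R *: normalized a.
Proof. by rewrite /normalized scalerA divff ?scale1r // zee_neq0. Qed.

Lemma normalized_hom a : homogeneous (weight a) (normalized a).
Proof. by move=> b /domZ_subset/P_hom. Qed.

Lemma normalized_coproduct a :
  coproduct (P a) =
    \sum_(i < (size a).+1) ((zee a)%:R / ((zee (take i a))%:R * (zee (drop i a))%:R)) *:
      tensor (P (take i a)) (P (drop i a)) <->
  coproduct (normalized a) =
    \sum_(i < (size a).+1) tensor (normalized (take i a)) (normalized (drop i a)).
Proof.
rewrite [coproduct (normalized a)]fgliftZ.
have -> : \sum_(i < (size a).+1) tensor (normalized (take i a)) (normalized (drop i a)) =
    (zee a)%:R^-1 *: \sum_(i < (size a).+1)
      ((zee a)%:R / ((zee (take i a))%:R * (zee (drop i a))%:R)) *: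
      tensor (P (take i a)) (P (drop i a)).
  rewrite scaler_sumr; apply: eq_bigr => i _; rewrite tensorZ scalerA; congr (_ *: _).
  by rewrite mulKf ?zee_neq0 // invfM.
split=> [<- //|]; apply: scalerI.
by rewrite invr_eq0 zee_neq0.
Qed.

Lemma qs_eval_normalized n a : qs_eval n (P a) = (zee a)%:R *: qs_eval n (normalized a).
Proof. by rewrite {1}normalizedK; exact: fgliftZ. Qed.

(** All shuffles are rearrangements of [a ++ b], so a single factor [zee (a ++ b)] normalizes the
    whole sum. *)
Lemma normalized_product a b n :
  qs_eval n (P a) * qs_eval n (P b) =
    ((zee a)%:R * (zee b)%:R / (zee (a ++ b))%:R) *: \sum_(c <- shuffle a b) qs_eval n (P c) <->
  qs_eval n (normalized a) * qs_eval n (normalized b) =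
    shuffle_sum (fun c => qs_eval n (normalized c)) a b.
Proof.
have -> : \sum_(c <- shuffle a b) qs_eval n (P c) =
    (zee (a ++ b))%:R *: shuffle_sum (fun c => qs_eval n (normalized c)) a b.
  rewrite /shuffle_sum scaler_sumr; apply: eq_big_seq => c /perm_shuffle/perm_zee <-.
  exact: qs_eval_normalized.
rewrite !qs_eval_normalized -scalerAl -scalerAr !scalerA divfK ?zee_neq0 //.
split=> [|-> //]; apply: scalerI.
by rewrite mulf_neq0 ?zee_neq0.
Qed.

(** Setting a single variable to 1 is a ring morphism, so the product formula passes to these
    coefficients. *)
Lemma qs_eval1_normalized a :
  meval (fun=> 1) (qs_eval 1 (normalized a)) = coeff (coarsest (weight a)) (normalized a).
Proof.
rewrite qs_evalE (_ : enum 'I_1 = [:: ord0]); last first.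
  by apply: (inj_map val_inj); rewrite val_enum_ord.
rewrite (fglift_monomial1 normalized_hom) mevalZ rmorphXn /= mevalXU.
by rewrite expr1n mulr1.
Qed.

Lemma coeff_normalized a b : coeff b (P a) = (zee a)%:R * coeff b (normalized a).
Proof. by rewrite {1}normalizedK coeffZ. Qed.

Lemma singleton_zee i : zee [:: i] = val i.
Proof. by rewrite /zee aut_cons /aut /parts big_nil /= big_seq1 !mul1n. Qed.

(** * From a nonnegative integral QPS basis to a total order *)

Lemma coeff_of_QPS_basis (c : composition -> composition -> int) :
  QPS_basis P -> (forall a b, 0 <= c a b) -> (forall a b, coeff b (P a) = (c a b)%:~R) ->
  exists le : rel posint, total_order le /\
    forall a b, coeff b (P a) =
      if refines_wrt le a b then (aut a)%:R / (aut2 a b)%:R else 0.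
Proof.
case=> _ prodP coprodP psP c_ge0 cP.
have q_coprod a := (normalized_coproduct a).1 (coprodP a).
pose phi a := coeff (coarsest (weight a)) (normalized a).
have chphi : shuffle_character phi.
  move=> a b; have /(congr1 (meval (fun=> 1))) := (normalized_product a b 1).1 (prodP a b 1%N).
  rewrite mevalM !qs_eval1_normalized => ->; rewrite /shuffle_sum raddf_sum.
  by apply: eq_bigr => d _; rewrite /= qs_eval1_normalized.
(* A word of length at most one is its only rearrangement, so the power sum condition at one
   variable equal to 1 determines [phi l]. *)
have phi_ps (l : composition) : (size l <= 1)%N -> (zee l)%:R * phi l = 1.
  move=> sl; have lP : is_partition l by case: l sl => [|? []].
  have pl : permutations l = [:: l] by case: l sl {lP} => [|i []].
  have := congr1 (meval (fun=> 1)) (psP l 1%N lP).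
  rewrite pl big_seq1 qs_eval_normalized mevalZ qs_eval1_normalized => ->.
  rewrite /power_sum rmorph_prod big1 // => i _.
  by rewrite raddf_sum /= big_ord1 rmorphXn /= mevalXU expr1n.
(* With the product of the parts restored, [aut a] times [f a] is an integer coefficient of
   [P a]. *)
pose f a := (\prod_(i <- parts a) i)%:R * phi a.
have chf : shuffle_character f.
  apply: twist_character => // a b d perm_d.
  by rewrite (perm_big (parts (a ++ b))) ?perm_map // /parts map_cat big_cat natrM.
have f_zee a : (aut a)%:R * f a = (c a (coarsest (weight a)))%:~R.
  by rewrite /f mulrA -natrM -cP coeff_normalized.
have f1 i : f [:: i] = 1.
  by have := phi_ps [:: i] isT; rewrite singleton_zee /f /parts /= big_seq1.
have f0 : f [::] = 1.
  by have := phi_ps [::] isT; rewrite /f /zee /aut /parts /= !big_nil.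
have [le le_ord fE] := nonneg_character_sorted charK0 chf f1 f0 (fun a => c_ge0 a _) f_zee.
have phiE a : phi a = sorted_inv_zee K le a.
  rewrite sorted_inv_zeeE -fE /f mulKf // (pcharf0P K).1 // -lt0n.
  exact: prod_parts_gt0.
exists le; split=> // a b; rewrite -zee_prod_blocks // coeff_normalized; congr (_ * _).
have q0 : coeff [::] (normalized [::]) = 1.
  by have := f0; rewrite /f /parts big_nil mul1r /phi /coarsest insubF.
rewrite (coeff_q_block normalized_hom q_coprod q0) block_coeffE; case: ifP => // _.
by apply: eq_bigr => s _; exact: phiE.
Qed.

(** * From a total order to a QPS basis *)

Lemma QPS_basis_of_coeff (le : rel posint) :
  is_basis P -> total_order le ->
  (forall a b, coeff b (P a) =
      if refines_wrt le a b then (aut a)%:R / (aut2 a b)%:R else 0) ->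
  QPS_basis P.
Proof.
move=> basisP le_ord cP; pose phi := sorted_inv_zee K le.
have phi0 : phi [::] = 1 by rewrite /phi /sorted_inv_zee /zee /aut /parts /= !big_nil invr1.
have cq a b : coeff b (normalized a) = block_coeff phi b a.
  rewrite block_coeffE; apply: (mulfI (zee_neq0 a)).
  by rewrite -coeff_normalized cP zee_prod_blocks.
have q0 : coeff [::] (normalized [::]) = 1 by rewrite cq.
(* The iterated convolution for [b ++ d] splits at the junction by associativity. *)
have q_coprod a : coproduct (normalized a) =
    \sum_(i < (size a).+1) tensor (normalized (take i a)) (normalized (drop i a)).
  apply/eqP/freeg_eqP => -[b d]; rewrite coeff_coproduct cq block_coeff_cat raddf_sum /=.
  by apply: eq_bigr => i _; rewrite coeff_tensor !cq.
have phiE a : coeff (coarsest (weight a)) (normalized a) = phi a.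
  by rewrite cq block_coeff_coarsest.
have chphi : shuffle_character (fun a => coeff (coarsest (weight a)) (normalized a)).
  move=> a b; rewrite (eq_shuffle_sum _ _ phiE) !phiE.
  exact: sorted_inv_zee_character.
have chq n : shuffle_character (fun a => qs_eval n (normalized a)).
  move=> a b; rewrite !qs_evalE (eq_shuffle_sum _ _ (fun a => qs_evalE n (normalized a))).
  by apply: (fglift_monomial_character normalized_hom q_coprod q0).
split=> // [a b n|a|l n _]; first exact/normalized_product/chq.
  exact/normalized_coproduct.
rewrite [LHS]fglift_sum.
transitivity (\sum_(a <- permutations l) (zee l)%:R *: qs_eval n (normalized a)).
  apply: eq_big_seq => a; rewrite mem_permutations => /perm_zee <-.
  exact: qs_eval_normalized.
have E0 : qs_eval n (normalized [::]) = 1.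
  by rewrite qs_evalE (fglift_monomial_q0 normalized_hom q_coprod q0).
(* The factor [aut l] turns the sum over rearrangements into a product over letters; each part [i]
   then cancels the value 1/i of [phi] at [[:: i]]. *)
rewrite -scaler_sumr /zee mulnC natrM -scalerA [(aut l)%:R *: _]scaler_nat.
have /= <- := prod_character_permutations l E0 (chq n); rewrite /power_sum.
elim: l => [|i l IH]; first by rewrite /parts !big_nil scale1r.
rewrite /parts /= !big_cons natrM -IH -scalerA scalerAr scalerAl.
congr (_ * _); rewrite qs_evalE (fglift_monomial_singleton normalized_hom q_coprod q0).
rewrite phiE /phi /sorted_inv_zee /= singleton_zee scalerA divff ?scale1r; last first.
  by rewrite -singleton_zee zee_neq0.
by rewrite big_map big_enum.
Qed.

End Main.

(** * Integrality and the equivalence *)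

Lemma refinement_coeff_int (K : fieldType) (charK0 : [pchar K] =i pred0) (le : rel posint) a b :
  (if refines_wrt le a b then (aut a)%:R / (aut2 a b)%:R else 0 : K) =
  (Posz (if refines_wrt le a b then aut a %/ aut2 a b else 0)%N)%:~R.
Proof.
rewrite -pmulrn; case: ifP => // /andP[ab _].
by rewrite pchar0_natf_div // dvdn_aut2.
Qed.

Theorem theorem6p3 (K : fieldType) (charK0 : [pchar K] =i pred0)
    (P : composition -> QSym K) (P_graded_basis : graded_basis P) :
  (QPS_basis P /\
   exists c : composition -> composition -> int,
     (forall a b : composition, 0 <= c a b) /\
     (forall a b : composition, coeff b (P a) = (c a b)%:~R))
  <->
  (exists le : rel posint,
     total_order le /\
     forall a b : composition,
       coeff b (P a) =
       (if refines_wrt le a b then (aut a)%:R / (aut2 a b)%:R else 0)).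
Proof.
case: (P_graded_basis) => homP basisP; split.
  by case=> qpsP [c [c_ge0 cP]]; apply: (coeff_of_QPS_basis charK0 homP qpsP c_ge0 cP).
case=> le [le_ord cP]; split; first exact: QPS_basis_of_coeff le_ord cP.
exists (fun a b => Posz (if refines_wrt le a b then aut a %/ aut2 a b else 0)%N).
by split=> // a b; rewrite cP refinement_coeff_int.
Qed.
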